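(* Let $R,S$ be rings and $M$ an $(R,S)$-bimodule. Then the following are equivalent. (1) The functor $\sigma_*=\mathrm{Hom}_S(M,-):\mathrm{Mod}\text{-}S\to\mathrm{Mod}\text{-}R$ is semiseparable. (2) The evaluation map $\mathrm{ev}_M:M^*\otimes_RM\to S$ is regular as a morphism of $S$-bimodules and $M\otimes_S\mathrm{ev}_M$ is surjective. (3) $S$ is $M$-semiseparable over $R$.
   Context: Rings are unital and associative; $\mathrm{Mod}\text{-}S$ is the category of right $S$-modules. $M^*=\mathrm{Hom}_S(M,S)$ (right $S$-linear maps) is an $(S,R)$-bimodule via $(sfr)(m)=s f(rm)$, and $\mathrm{ev}_M(f\otimes_Rm)=f(m)$. For $Y\in\mathrm{Mod}\text{-}S$, $\mathrm{Hom}_S(M,Y)$ is a right $R$-module via $(fr)(m)=f(rm)$. For an $S$-bimodule $X$, $X^S=\{x\in X\mid sx=xs\ \forall s\in S\}$. $S$ is $M$-semiseparable over $R$ if there exists an element $\sum_if_i\otimes_Rm_i\in(M^*\otimes_RM)^S$ such that $\sum_imf_i(m_i)=m$ for every $m\in M$. For a functor $F:\mathcal{C}\to\mathcal{D}$ let $\mathcal{F}^F:\mathrm{Hom}_{\mathcal{C}}(-,-)\to\mathrm{Hom}_{\mathcal{D}}(F-,F-)$ be the natural transformation (of functors $\mathcal{C}^{\mathrm{op}}\times\mathcal{C}\to\mathsf{Set}$) with $\mathcal{F}^F_{X,Y}(f)=F(f)$. $F$ is semiseparable if there is a natural transformation $\mathcal{P}^F:\mathrm{Hom}_{\mathcal{D}}(F-,F-)\to\mathrm{Hom}_{\mathcal{C}}(-,-)$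 with $\mathcal{F}^F\circ\mathcal{P}^F\circ\mathcal{F}^F=\mathcal{F}^F$. A morphism $f$ in a category is regular if there is a morphism $g$ in that category with $f\circ g\circ f=f$. *)

(* Defs.v *)
From HB Require Import structures.
From mathcomp Require Import all_boot all_algebra.
From mathcomp Require Import boolp.
From mathcomp Require Import freeg.

Set Implicit Arguments.
Unset Strict Implicit.
Unset Printing Implicit Defensive.

Import GRing.Theory.
Local Open Scope ring_scope.

Reserved Notation "r *l: m" (at level 40, left associativity).
Reserved Notation "m *r: s" (at level 40, left associativity).
Reserved Notation "a *t: b" (at level 40, left associativity).

Record category := Category {
  obj :> Type;
  mor : obj -> obj -> Type;
  idmor : forall X, mor X X;
  mcomp : forall X Y Z, mor Y Z -> mor X Y -> mor X Z;
  mcompA : forall W X Y Z (h : mor Y Z) (g : mor X Y) (f : mor W X),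
    mcomp h (mcomp g f) = mcomp (mcomp h g) f;
  mcomp1m : forall X Y (f : mor X Y), mcomp (idmor Y) f = f;
  mcompm1 : forall X Y (f : mor X Y), mcomp f (idmor X) = f }.
Arguments mor {c}.
Arguments idmor {c}.
Arguments mcomp {c X Y Z}.

Record functor (C D : category) := Functor {
  fobj :> C -> D;
  fmor : forall X Y : C, mor X Y -> mor (fobj X) (fobj Y);
  fmor1 : forall X, fmor (idmor X) = idmor (fobj X);
  fmor_comp : forall X Y Z (g : mor Y Z) (f : mor X Y),
    fmor (mcomp g f) = mcomp (fmor g) (fmor f) }.
Arguments fmor {C D} f0 {X Y}.

(* A natural transformation Hom_D(F-,F-) -> Hom_C(-,-) of functors
   C^op x C -> Set: the naturality square at (h, k) : (X, Y) -> (X', Y'),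
   where h : X' -> X since the first variable is contravariant. *)
Record hom_nat_trans (C D : category) (F : functor C D) := HomNatTrans {
  hnt :> forall X Y : C, mor (F X) (F Y) -> mor X Y;
  hnt_natural : forall (X X' Y Y' : C) (h : mor X' X) (k : mor Y Y')
      (g : mor (F X) (F Y)),
    hnt (mcomp (fmor F k) (mcomp g (fmor F h))) = mcomp k (mcomp (hnt g) h) }.

Definition semiseparable (C D : category) (F : functor C D) : Prop :=
  exists P : hom_nat_trans F,
    forall (X Y : C) (f : mor X Y), fmor F (P X Y (fmor F f)) = fmor F f.

Definition regular_mor (C : category) (X Y : C) (f : mor X Y) : Prop :=
  exists g : mor Y X, mcomp f (mcomp g f) = f.

(* Rings are pzRingType, so that the zero ring is allowed.  A right S-module
   is a left module over the converse ring S^c. *)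

Definition ract (S : pzRingType) (M : lmodType S^c) (m : M) (s : S) : M :=
  (s : S^c) *: m.
Notation "m *r: s" := (ract m s) : ring_scope.

(* bimodType R S: (R,S)-bimodules, left over R and right over S. *)
HB.mixin Record RightModule_isBimodule (R S : pzRingType) (M : Type)
    of GRing.Lmodule S^c M := {
  lact : R -> M -> M;
  lactA : forall r r' m, lact r (lact r' m) = lact (r * r') m;
  lact1 : forall m, lact 1 m = m;
  lactDr : forall r m m', lact r (m + m') = lact r m + lact r m';
  lactDl : forall r r' m, lact (r + r') m = lact r m + lact r' m;
  lactZ : forall r (s : S^c) m, lact r (s *: m) = s *: lact r m }.

#[short(type="bimodType")]
HB.structure Definition Bimodule (R S : pzRingType) :=
  {M of RightModule_isBimodule R S M & GRing.Lmodule S^c M}.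

Notation "r *l: m" := (lact r m) : ring_scope.

Section RightModuleTheory.
Variables (S : pzRingType) (M : lmodType S^c).
Implicit Types (m : M) (s : S).

Lemma ractA m s s' : m *r: s *r: s' = m *r: (s * s').
Proof. exact: scalerA. Qed.
Lemma ract1 m : m *r: 1 = m.
Proof. exact: scale1r. Qed.
Lemma ractDl m m' s : (m + m') *r: s = m *r: s + m' *r: s.
Proof. exact: scalerDr. Qed.
Lemma ractDr m s s' : m *r: (s + s') = m *r: s + m *r: s'.
Proof. exact: scalerDl. Qed.
End RightModuleTheory.

Lemma lact_ract (R S : pzRingType) (M : bimodType R S) (r : R) (m : M) (s : S) :
  r *l: (m *r: s) = (r *l: m) *r: s.
Proof. exact: lactZ. Qed.

Lemma lact0 (R S : pzRingType) (M : bimodType R S) (r : R) :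
  r *l: (0 : M) = 0.
Proof. by apply: (addrI (r *l: 0)); rewrite -lactDr !addr0. Qed.

Lemma lin_ract (S : pzRingType) (X Y : lmodType S^c) (f : {linear X -> Y})
  (x : X) (s : S) : f (x *r: s) = f x *r: s.
Proof. exact: linearZ. Qed.

Lemma linear_ext (S : pzRingType) (X Y : lmodType S) (f g : {linear X -> Y}) :
  f =1 g -> f = g.
Proof.
case: f g => [f [[f1] [f2]]] [g [[g1] [g2]]] /= fg.
have {}fg : f = g by apply: funext.
by move: g1 g2; case: _ / fg => g1 g2; congr GRing.Linear.Pack;
   congr GRing.Linear.Class; congr (_ _); exact: Prop_irrelevance.
Qed.

Definition mk_linear (S : pzRingType) (X Y : lmodType S) (f : X -> Y)
  (fP : linear f) : {linear X -> Y} :=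
  HB.pack f (GRing.isLinear.Build S X Y *:%R f fP).

Section BimoduleHom.
Variables (R S : pzRingType).

Record bimodHom (X Y : bimodType R S) := BimodHom {
  bimodHom_lin :> {linear X -> Y};
  bimodHom_lact : forall r x, bimodHom_lin (r *l: x) = r *l: bimodHom_lin x }.

Lemma bimodHom_ext (X Y : bimodType R S) (f g : bimodHom X Y) :
  f =1 g -> f = g.
Proof.
case: f g => [f fP] [g gP] /= /linear_ext fg; case: _ / fg gP => gP.
by congr BimodHom; exact: Prop_irrelevance.
Qed.

Definition bimod_id (X : bimodType R S) : bimodHom X X :=
  @BimodHom X X idfun (fun r x => erefl).

Lemma bimod_comp_lact (X Y Z : bimodType R S) (g : bimodHom Y Z)
  (f : bimodHom X Y) r x : (g \o f) (r *l: x) = r *l: (g \o f) x.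
Proof. by rewrite /= !bimodHom_lact. Qed.

Definition bimod_comp (X Y Z : bimodType R S) (g : bimodHom Y Z)
  (f : bimodHom X Y) : bimodHom X Z :=
  @BimodHom X Z (g \o f) (bimod_comp_lact g f).
End BimoduleHom.

Definition BiMod (R S : pzRingType) : category.
Proof.
by refine (@Category (bimodType R S) (@bimodHom R S) (@bimod_id R S)
  (@bimod_comp R S) _ _ _) => *; apply: bimodHom_ext.
Defined.

Definition RightMod (S : pzRingType) : category.
Proof.
by refine (@Category (lmodType S^c) (fun X Y => {linear X -> Y})
  (fun X => idfun) (fun X Y Z g f => g \o f) _ _ _) => *; apply: linear_ext.
Defined.

Definition HomR (R S : pzRingType) (M : bimodType R S) (Y : lmodType S^c) :=
  {linear M -> Y}.
Identity Coercion HomR_linear : HomR >-> GRing.Linear.type.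

Section HomR.
Variables (R S : pzRingType) (M : bimodType R S) (Y : lmodType S^c).
Implicit Types f g h : HomR M Y.

HB.instance Definition _ := gen_eqMixin (HomR M Y).
HB.instance Definition _ := gen_choiceMixin (HomR M Y).

Lemma homR_ext f g : (forall m, f m = g m) -> f = g.
Proof. exact: linear_ext. Qed.

Fact zero_linear : linear (fun _ : M => 0 : Y).
Proof. by move=> a x y; rewrite scaler0 addr0. Qed.
Fact opp_linear f : linear (fun m => - f m).
Proof. by move=> a x y; rewrite linearP opprD scalerN. Qed.
Fact add_linear f g : linear (fun m => f m + g m).
Proof. by move=> a x y; rewrite !linearP scalerDr addrACA. Qed.
Fact act_linear (r : R) f : linear (fun m => f (r *l: m)).
Proof. by move=> a x y; rewrite lactDr lactZ linearP. Qed.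

Definition homR_zero : HomR M Y := mk_linear zero_linear.
Definition homR_opp f : HomR M Y := mk_linear (opp_linear f).
Definition homR_add f g : HomR M Y := mk_linear (add_linear f g).
Definition homR_act (r : R) f : HomR M Y := mk_linear (act_linear r f).

Fact homR_addA : associative homR_add.
Proof. by move=> f g h; apply: homR_ext => m /=; rewrite addrA. Qed.
Fact homR_addC : commutative homR_add.
Proof. by move=> f g; apply: homR_ext => m /=; rewrite addrC. Qed.
Fact homR_add0 : left_id homR_zero homR_add.
Proof. by move=> f; apply: homR_ext => m /=; rewrite add0r. Qed.
Fact homR_addN : left_inverse homR_zero homR_opp homR_add.
Proof. by move=> f; apply: homR_ext => m /=; rewrite addNr. Qed.

HB.instance Definition _ := GRing.isZmodule.Build (HomR M Y)
  homR_addA homR_addC homR_add0 homR_addN.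

Fact homR_actA (a b : R^c) f : homR_act a (homR_act b f) = homR_act (a * b) f.
Proof. by apply: homR_ext => m /=; rewrite lactA. Qed.
Fact homR_act1 : left_id (1 : R^c) homR_act.
Proof. by move=> f; apply: homR_ext => m /=; rewrite lact1. Qed.
Fact homR_actDr : right_distributive (homR_act : R^c -> _) +%R.
Proof. by move=> r f g; apply: homR_ext. Qed.
Fact homR_actDl f : {morph (homR_act : R^c -> _)^~ f : a b / a + b}.
Proof. by move=> a b; apply: homR_ext => m /=; rewrite lactDl linearD. Qed.

HB.instance Definition _ := GRing.Zmodule_isLmodule.Build R^c (HomR M Y)
  homR_actA homR_act1 homR_actDr homR_actDl.

Lemma homR_ractE f r m : (f *r: r) m = f (r *l: m).
Proof. by []. Qed.
Lemma homR_addE f g m : (f + g) m = f m + g m.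
Proof. by []. Qed.
Lemma homR_oppE f m : (- f) m = - f m.
Proof. by []. Qed.
Lemma homR_0E m : (0 : HomR M Y) m = 0.
Proof. by []. Qed.
End HomR.

Section HomFunctor.
Variables (R S : pzRingType) (M : bimodType R S).

Definition homR_post (X Y : lmodType S^c) (g : {linear X -> Y})
  (f : HomR M X) : HomR M Y := g \o f.

Lemma homR_post_linear (X Y : lmodType S^c) (g : {linear X -> Y}) :
  linear (homR_post g).
Proof. by move=> a f f'; apply: homR_ext => m /=; rewrite linearD. Qed.

Definition sigma_star : functor (RightMod S) (RightMod R).
Proof.
refine (@Functor (RightMod S) (RightMod R) (fun Y : lmodType S^c => HomR M Y)
  (fun X Y g => mk_linear (homR_post_linear g)) _ _).
- by move=> X; apply: linear_ext => f; apply: homR_ext.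
- by move=> X Y Z g f; apply: linear_ext => h; apply: homR_ext.
Defined.
End HomFunctor.

Definition self_bimod (S : pzRingType) : Type := (S^c)^o.

Section SelfBimod.
Variable S : pzRingType.
HB.instance Definition _ := GRing.Lmodule.copy (self_bimod S) (S^c)^o.

Definition self_lact (s : S) (x : self_bimod S) : self_bimod S := s * (x : S).

Fact self_lactA r r' m : self_lact r (self_lact r' m) = self_lact (r * r') m.
Proof. exact: (@mulrA S). Qed.
Fact self_lact1 m : self_lact 1 m = m.
Proof. exact: (@mul1r S). Qed.
Fact self_lactDr r m m' : self_lact r (m + m') = self_lact r m + self_lact r m'.
Proof. exact: (@mulrDr S). Qed.
Fact self_lactDl r r' m : self_lact (r + r') m = self_lact r m + self_lact r' m.
Proof. exact: (@mulrDl S). Qed.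
Fact self_lactZ r (s : S^c) m : self_lact r (s *: m) = s *: self_lact r m.
Proof. exact: (@mulrA S r m s). Qed.

HB.instance Definition _ := RightModule_isBimodule.Build S S (self_bimod S)
  self_lactA self_lact1 self_lactDr self_lactDl self_lactZ.

Lemma self_lactE (s : S) (x : self_bimod S) : s *l: x = s * (x : S) :> S.
Proof. by []. Qed.
Lemma self_ractE (x : self_bimod S) (s : S) : x *r: s = (x : S) * s :> S.
Proof. by []. Qed.
End SelfBimod.

Definition dualmod (R S : pzRingType) (M : bimodType R S) : Type :=
  HomR M (self_bimod S).
Identity Coercion dual_HomR : dualmod >-> HomR.

Section Dual.
Variables (R S : pzRingType) (M : bimodType R S).
HB.instance Definition _ :=
  GRing.Lmodule.copy (dualmod M) (HomR M (self_bimod S)).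
Implicit Types f g : dualmod M.

Fact dual_lact_linear (s : S) f : linear (fun m => s *l: f m).
Proof. by move=> a x y; rewrite linearP lactDr lactZ. Qed.

Definition dual_lact (s : S) f : dualmod M := mk_linear (dual_lact_linear s f).

Fact dual_lactA s s' f : dual_lact s (dual_lact s' f) = dual_lact (s * s') f.
Proof. by apply: homR_ext => m; apply: lactA. Qed.
Fact dual_lact1 f : dual_lact 1 f = f.
Proof. by apply: homR_ext => m; apply: lact1. Qed.
Fact dual_lactDr s f g : dual_lact s (f + g) = dual_lact s f + dual_lact s g.
Proof. by apply: homR_ext => m; apply: lactDr. Qed.
Fact dual_lactDl s s' f : dual_lact (s + s') f = dual_lact s f + dual_lact s' f.
Proof. by apply: homR_ext => m; apply: lactDl. Qed.
Fact dual_lactZ s (r : R^c) f : dual_lact s (r *: f) = r *: dual_lact s f.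
Proof. by apply: homR_ext. Qed.

HB.instance Definition _ := RightModule_isBimodule.Build S R (dualmod M)
  dual_lactA dual_lact1 dual_lactDr dual_lactDl dual_lactZ.

Lemma dual_actE (s : S) f (r : R) m :
  (s *l: f *r: r) m = s * (f (r *l: m) : S) :> S.
Proof. by []. Qed.
End Dual.

Section Tensor.
Variables (Q R T : pzRingType) (A : bimodType Q R) (B : bimodType R T).

(* The subgroup of the free abelian group on A x B generated by the relations
   of R-balanced biadditivity. *)
Inductive tensor_rel : {freeg (A * B) / int} -> Prop :=
| tensor_rel0 : tensor_rel 0
| tensor_relB x y : tensor_rel x -> tensor_rel y -> tensor_rel (x - y)
| tensor_relDl a a' b : tensor_rel
    ([freeg [:: (1, (a + a', b))]]
     - ([freeg [:: (1, (a, b))]] + [freeg [:: (1, (a', b))]]))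
| tensor_relDr a b b' : tensor_rel
    ([freeg [:: (1, (a, b + b'))]]
     - ([freeg [:: (1, (a, b))]] + [freeg [:: (1, (a, b'))]]))
| tensor_relM a r b : tensor_rel
    ([freeg [:: (1, (a *r: r, b))]] - [freeg [:: (1, (a, r *l: b))]]).

Definition tensor_pred : {pred {freeg (A * B) / int}} :=
  fun x => `[< tensor_rel x >].

Fact tensor_pred_closed : zmod_closed tensor_pred.
Proof.
split=> [|x y]; first exact/asboolP/tensor_rel0.
by move=> /asboolP xP /asboolP yP; apply/asboolP/tensor_relB.
Qed.
HB.instance Definition _ := GRing.isZmodClosed.Build _ tensor_pred
  tensor_pred_closed.

Definition tensor : Type := Quotient.quot tensor_pred.
HB.instance Definition _ := GRing.Zmodule.on tensor.
HB.instance Definition _ := ZmodQuotient.on tensor.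

Definition tens (a : A) (b : B) : tensor :=
  \pi_tensor%qT [freeg [:: (1, (a, b))]].

Definition balanced (G : zmodType) (f : A -> B -> G) : Prop :=
  [/\ forall a a' b, f (a + a') b = f a b + f a' b,
      forall a b b', f a (b + b') = f a b + f a b' &
      forall a r b, f (a *r: r) b = f a (r *l: b)].

(* The map a (x) b |-> f a b; it is only meaningful when f is balanced. *)
Definition tens_lift (G : zmodType) (f : A -> B -> G) (t : tensor) : G :=
  fglift (fun ab : A * B => f ab.1 ab.2 : zmodule G) (repr t).

Notation gen a b := ([freeg [:: (1, (a, b))]] : {freeg (A * B) / int}).

Definition free_lift (G : zmodType) (f : A -> B -> G) :
    {freeg (A * B) / int} -> zmodule G :=
  fglift (fun ab : A * B => f ab.1 ab.2 : zmodule G).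

Fact free_liftB (G : zmodType) (f : A -> B -> G) x y :
  free_lift f (x - y) = free_lift f x - free_lift f y.
Proof. exact: lift_is_additive. Qed.

Fact free_lift0 (G : zmodType) (f : A -> B -> G) : free_lift f 0 = 0.
Proof. by rewrite -(subrr 0) free_liftB subrr. Qed.

Fact free_liftD (G : zmodType) (f : A -> B -> G) x y :
  free_lift f (x + y) = free_lift f x + free_lift f y.
Proof.
by rewrite -{1}(opprK y) -[- y]sub0r !free_liftB free_lift0 sub0r opprK.
Qed.

Fact free_lift_gen (G : zmodType) (f : A -> B -> G) a b :
  free_lift f (gen a b) = f a b.
Proof. by rewrite /free_lift liftU scale1r. Qed.

Fact tensor_piP x y :
  tensor_rel (x - y) -> \pi_tensor%qT x = \pi_tensor%qT y.
Proof.
move=> xy; apply/eqP; rewrite -(@Quotient.idealrBE _ tensor_pred).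
exact/asboolP.
Qed.

Fact tens_lift_pi (G : zmodType) (f : A -> B -> G) x : balanced f ->
  tens_lift f (\pi_tensor%qT x) = free_lift f x.
Proof.
move=> [fDl fDr fM]; apply/subr0_eq; rewrite /tens_lift -/(free_lift f _).
rewrite -free_liftB.
set y := repr _.
have: tensor_rel (y - x).
  apply/asboolP; rewrite -[asbool _]/(y - x \in tensor_pred).
  by rewrite (@Quotient.idealrBE _ tensor_pred) /y reprK.
elim=> {y x} [|x y _ xE _ yE|a a' b|a b b'|a r b].
- by rewrite free_lift0.
- by rewrite free_liftB xE yE subrr.
- by rewrite free_liftB free_liftD !free_lift_gen fDl subrr.
- by rewrite free_liftB free_liftD !free_lift_gen fDr subrr.
- by rewrite free_liftB !free_lift_gen fM subrr.
Qed.

Lemma tens_balanced : balanced tens.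
Proof.
split=> [a a' b|a b b'|a r b]; rewrite /tens -?raddfD; apply: tensor_piP.
- exact: tensor_relDl.
- exact: tensor_relDr.
- exact: tensor_relM.
Qed.

Lemma tensDl a a' b : tens (a + a') b = tens a b + tens a' b.
Proof. by case: tens_balanced. Qed.
Lemma tensDr a b b' : tens a (b + b') = tens a b + tens a b'.
Proof. by case: tens_balanced. Qed.
Lemma tensM a r b : tens (a *r: r) b = tens a (r *l: b).
Proof. by case: tens_balanced. Qed.

Lemma tens_liftE (G : zmodType) (f : A -> B -> G) a b :
  balanced f -> tens_lift f (tens a b) = f a b.
Proof. by move=> fP; rewrite tens_lift_pi // free_lift_gen. Qed.

Lemma tens_liftD (G : zmodType) (f : A -> B -> G) : balanced f ->
  {morph tens_lift f : x y / x + y}.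
Proof.
move=> fP x y; rewrite -[x]reprK -[y]reprK -raddfD.
by rewrite !tens_lift_pi // free_liftD.
Qed.

Lemma tens_ind (P : tensor -> Prop) :
  P 0 -> (forall x y, P x -> P y -> P (x - y)) ->
  (forall a b, P (tens a b)) -> forall t, P t.
Proof.
move=> P0 PB Pt t; rewrite -[t]reprK; move: (repr t) => {}t.
have PN x : P x -> P (- x) by move=> Px; rewrite -sub0r; apply: PB.
have PD x y : P x -> P y -> P (x + y).
  by move=> Px Py; rewrite -[y]opprK; apply/PB/PN.
rewrite -[t]freeg_sumE raddf_sum; apply: big_ind => //= -[a b] _.
rewrite -[coeff _ _]intz -freegU_mulz raddfMz.
have PMn n : P (tens a b *+ n).
  by elim: n => [|n IHn]; rewrite ?mulr0n // mulrS; apply: PD.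
case: (coeff _ _) => n; first exact: PMn.
exact/PN/PMn.
Qed.

Lemma tens_lift0 (G : zmodType) (f : A -> B -> G) : balanced f ->
  tens_lift f 0 = 0.
Proof.
by move=> fP; apply: (addrI (tens_lift f 0)); rewrite -tens_liftD ?addr0.
Qed.

Lemma tens_liftB (G : zmodType) (f : A -> B -> G) : balanced f ->
  {morph tens_lift f : x y / x - y}.
Proof.
by move=> fP x y; apply: (addIr (tens_lift f y)); rewrite -tens_liftD // !subrK.
Qed.

Lemma tens_ext (G : zmodType) (f g : tensor -> G) :
  {morph f : x y / x - y} -> {morph g : x y / x - y} ->
  (forall a b, f (tens a b) = g (tens a b)) -> f =1 g.
Proof.
move=> fB gB fg; apply: tens_ind => // [|x y fgx fgy].
  by rewrite -(subrr 0) fB gB !subrr.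
by rewrite fB gB fgx fgy.
Qed.

Definition tensor_lact (q : Q) : tensor -> tensor :=
  tens_lift (fun a b => tens (q *l: a) b).
Definition tensor_ract (t : T^c) : tensor -> tensor :=
  tens_lift (fun a b => tens a (t *: b)).

Fact tensor_lact_balanced (q : Q) : balanced (fun a b => tens (q *l: a) b).
Proof.
by split=> *; rewrite -?tensDl -?tensDr -?lactDr // lact_ract tensM.
Qed.

Fact tensor_ract_balanced (t : T^c) : balanced (fun a b => tens a (t *: b)).
Proof.
by split=> *; rewrite -?tensDl -?tensDr -?scalerDr // tensM lactZ.
Qed.

Fact tensor_lactB q x y :
  tensor_lact q (x - y) = tensor_lact q x - tensor_lact q y.
Proof. exact/tens_liftB/tensor_lact_balanced. Qed.
Fact tensor_ractB t x y :
  tensor_ract t (x - y) = tensor_ract t x - tensor_ract t y.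
Proof. exact/tens_liftB/tensor_ract_balanced. Qed.
Fact tensor_lactE q a b :
  tensor_lact q (tens a b) = tens (q *l: a) b.
Proof. exact/tens_liftE/tensor_lact_balanced. Qed.
Fact tensor_ractE t a b :
  tensor_ract t (tens a b) = tens a (t *: b).
Proof. exact/tens_liftE/tensor_ract_balanced. Qed.

Fact tensor_ractA t t' x :
  tensor_ract t (tensor_ract t' x) = tensor_ract (t * t') x.
Proof.
move: x; apply: tens_ext => [x y|x y|a b]; first by rewrite !tensor_ractB.
  by rewrite tensor_ractB.
by rewrite !tensor_ractE scalerA.
Qed.
Fact tensor_ract1 : left_id 1 tensor_ract.
Proof.
apply: (tens_ext (g := id)) => [x y|//|a b]; first by rewrite tensor_ractB.
by rewrite tensor_ractE scale1r.
Qed.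
Fact tensor_ractDr : right_distributive tensor_ract +%R.
Proof. by move=> t x y; apply/tens_liftD/tensor_ract_balanced. Qed.
Fact tensor_ractDl x :
  {morph tensor_ract^~ x : t t' / t + t'}.
Proof.
move=> t t'; move: x.
apply: (tens_ext (g := fun x => tensor_ract t x + tensor_ract t' x)).
- by move=> x y; rewrite tensor_ractB.
- by move=> x y; rewrite !tensor_ractB opprD addrACA.
- by move=> a b; rewrite !tensor_ractE scalerDl tensDr.
Qed.

HB.instance Definition _ := GRing.Zmodule_isLmodule.Build T^c tensor
  tensor_ractA tensor_ract1 tensor_ractDr tensor_ractDl.

Fact tensor_lactA q q' x :
  tensor_lact q (tensor_lact q' x) = tensor_lact (q * q') x.
Proof.
move: x; apply: tens_ext => [x y|x y|a b]; first by rewrite !tensor_lactB.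
  by rewrite tensor_lactB.
by rewrite !tensor_lactE lactA.
Qed.
Fact tensor_lact1 x : tensor_lact 1 x = x.
Proof.
move: x; apply: (tens_ext (g := id)) => [x y|//|a b].
  by rewrite tensor_lactB.
by rewrite tensor_lactE lact1.
Qed.
Fact tensor_lactDr q x y :
  tensor_lact q (x + y) = tensor_lact q x + tensor_lact q y.
Proof. by apply/tens_liftD/tensor_lact_balanced. Qed.
Fact tensor_lactDl q q' x :
  tensor_lact (q + q') x = tensor_lact q x + tensor_lact q' x.
Proof.
move: x; apply: (tens_ext (g := fun x => tensor_lact q x + tensor_lact q' x)).
- by move=> x y; rewrite tensor_lactB.
- by move=> x y; rewrite !tensor_lactB opprD addrACA.
- by move=> a b; rewrite !tensor_lactE lactDl tensDl.
Qed.
Fact tensor_lactZ q (t : T^c) x : tensor_lact q (t *: x) = t *: tensor_lact q x.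
Proof.
move: x; apply: (tens_ext (f := fun x => tensor_lact q (tensor_ract t x))
                          (g := fun x => tensor_ract t (tensor_lact q x))).
- by move=> x y; rewrite tensor_ractB tensor_lactB.
- by move=> x y; rewrite tensor_lactB tensor_ractB.
- by move=> a b; rewrite tensor_ractE !tensor_lactE tensor_ractE.
Qed.

HB.instance Definition _ := RightModule_isBimodule.Build Q T tensor
  tensor_lactA tensor_lact1 tensor_lactDr tensor_lactDl tensor_lactZ.

Lemma tens_lactE (q : Q) a b : q *l: tens a b = tens (q *l: a) b.
Proof. exact: tensor_lactE. Qed.
Lemma tens_ractE a b (t : T) : tens a b *r: t = tens a (b *r: t).
Proof. exact: tensor_ractE. Qed.
End Tensor.

Notation "a *t: b" := (tens a b) : ring_scope.

Section TensorHom.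
Variables (Q R T : pzRingType) (A : bimodType Q R) (B : bimodType R T).

Lemma tens_lift_linear (X : bimodType Q T) (f : A -> B -> X) : balanced f ->
  (forall a b (t : T), f a (b *r: t) = f a b *r: t) -> linear (tens_lift f).
Proof.
move=> fP fT t x y; rewrite tens_liftD //; congr (_ + _).
move: x; apply: (tens_ext (f := fun x => tens_lift f (t *: x))
                          (g := fun x => t *: tens_lift f x)).
- by move=> x z; rewrite scalerBr tens_liftB.
- by move=> x z; rewrite tens_liftB // scalerBr.
- by move=> a b; rewrite [t *: _]tens_ractE !tens_liftE // fT.
Qed.

Lemma tens_lift_lact (X : bimodType Q T) (f : A -> B -> X) : balanced f ->
  (forall (q : Q) a b, f (q *l: a) b = q *l: f a b) ->
  forall q x, tens_lift f (q *l: x) = q *l: tens_lift f x.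
Proof.
move=> fP fQ q; apply: (tens_ext (f := fun x => tens_lift f (q *l: x))
                                 (g := fun x => q *l: tens_lift f x)).
- move=> x z; rewrite -tens_liftB //; congr tens_lift.
  by apply: (addIr (q *l: z)); rewrite -lactDr !subrK.
- move=> x z; rewrite tens_liftB //.
  by apply: (addIr (q *l: tens_lift f z)); rewrite -lactDr !subrK.
- by move=> a b; rewrite tens_lactE !tens_liftE // fQ.
Qed.

Definition tens_hom (X : bimodType Q T) (f : A -> B -> X) (fP : balanced f)
    (fQ : forall (q : Q) a b, f (q *l: a) b = q *l: f a b)
    (fT : forall a b (t : T), f a (b *r: t) = f a b *r: t) :
  bimodHom (tensor A B) X :=
  @BimodHom Q T (tensor A B) X (mk_linear (tens_lift_linear fP fT))
    (tens_lift_lact fP fQ).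

Variables (A' : bimodType Q R) (B' : bimodType R T).
Variables (f : bimodHom A A') (g : bimodHom B B').

Definition tmap (a : A) (b : B) : tensor A' B' := f a *t: g b.
Fact tmap_balanced : balanced tmap.
Proof.
split=> *; rewrite /tmap ?linearD ?tensDl ?tensDr //.
by rewrite lin_ract bimodHom_lact tensM.
Qed.
Fact tmap_lact (q : Q) a b : tmap (q *l: a) b = q *l: tmap a b.
Proof. by rewrite /tmap bimodHom_lact tens_lactE. Qed.
Fact tmap_ract a b (t : T) : tmap a (b *r: t) = tmap a b *r: t.
Proof. by rewrite /tmap lin_ract tens_ractE. Qed.

Definition tens_map : bimodHom (tensor A B) (tensor A' B') :=
  tens_hom tmap_balanced tmap_lact tmap_ract.

Lemma tens_mapE a b : tens_map (a *t: b) = f a *t: g b.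
Proof. exact: (tens_liftE _ _ tmap_balanced). Qed.
End TensorHom.

Section Evaluation.
Variables (R S : pzRingType) (M : bimodType R S).

Definition ev_fun (f : dualmod M) (m : M) : self_bimod S := f m.
Fact ev_balanced : balanced ev_fun.
Proof. by split=> // f m m'; rewrite /ev_fun linearD. Qed.
Fact ev_lact (s : S) f m : ev_fun (s *l: f) m = s *l: ev_fun f m.
Proof. by []. Qed.
Fact ev_ract f m (s : S) : ev_fun f (m *r: s) = ev_fun f m *r: s.
Proof. exact: lin_ract. Qed.

Definition ev : bimodHom (tensor (dualmod M) M) (self_bimod S) :=
  tens_hom ev_balanced ev_lact ev_ract.

Lemma evE (f : dualmod M) (m : M) : ev (f *t: m) = f m.
Proof. by rewrite -[RHS]/(ev_fun f m) -(tens_liftE _ _ ev_balanced). Qed.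

Definition id_tens_ev :
  bimodHom (tensor M (tensor (dualmod M) M)) (tensor M (self_bimod S)) :=
  tens_map (bimod_id M) ev.
End Evaluation.

Definition bimod_invariant (S : pzRingType) (X : bimodType S S)
    (x : X) : Prop :=
  forall s : S, s *l: x = x *r: s.

Definition M_semiseparable (R S : pzRingType) (M : bimodType R S) : Prop :=
  exists (n : nat) (f : 'I_n -> dualmod M) (m : 'I_n -> M),
    bimod_invariant (\sum_(i < n) f i *t: m i) /\
    forall x : M, \sum_(i < n) x *r: f i (m i) = x.

(* Main.v *)
(** A retraction [P] for [Hom_S(M,-)] sends the coevaluation
    [f |-> (m |-> f (x) m)] to a right linear map [gamma : S -> M* (x)_R M].
    Naturality makes [gamma] left linear, identifies [ev o gamma] with [P(id)]
    at [S], and shows that [e = ev (gamma 1)] acts as the identity on [M]; this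
    gives (2).  In (2), regularity makes [M (x) (ev o gamma)] fix the image of
    [M (x) ev], which is everything, so [m e = m] and [gamma 1] is the invariant
    element of (3).  From [\sum_i f_i (x) m_i] as in (3), the retraction is
    [P(g)(x) = \sum_i g (x f_i(-)) (m_i)]; it is right linear because the
    element is invariant, and [P(Hom_S(M,h))(x) = h (x e)]. *)

Require Import Defs.
From mathcomp Require Import all_boot all_algebra.

Set Implicit Arguments.
Unset Strict Implicit.
Unset Printing Implicit Defensive.

Import GRing.Theory.
Local Open Scope ring_scope.

(** * Tensors as finite sums *)

Section Tensor.
Variables (Q R T : pzRingType) (A : bimodType Q R) (B : bimodType R T).

Lemma tensNl (a : A) (b : B) : (- a) *t: b = - (a *t: b).
Proof.
have tens0 : (0 : A) *t: b = 0.
  by apply: (addrI (0 *t: b)); rewrite -tensDl !addr0.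
by apply/(addrI (a *t: b)); rewrite -tensDl !subrr.
Qed.

Lemma tensor_sum (t : tensor A B) :
  exists (n : nat) (a : 'I_n -> A) (b : 'I_n -> B),
    t = \sum_(i < n) a i *t: b i.
Proof.
elim/tens_ind: t => [|x y [n [a [b ->]]] [p [c [d ->]]]|a b].
- by exists 0%N, (fun=> 0), (fun=> 0); rewrite big_ord0.
(* The two sums are concatenated; the minus sign is absorbed by the left factors of the second. *)
- exists (n + p)%N,
    (fun i => match split i with inl j => a j | inr k => - c k end),
    (fun i => match split i with inl j => b j | inr k => d k end).
  rewrite big_split_ord -sumrN /=; congr (_ + _); apply: eq_bigr => i _.
    by rewrite (unsplitK (inl i)).
  by rewrite (unsplitK (inr i)) tensNl.
- by exists 1%N, (fun=> a), (fun=> b); rewrite big_ord1.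
Qed.
End Tensor.

Section RightAction.
Variables (S : pzRingType) (X : lmodType S^c).

Fact ract_elem_linear (x : X) : linear (fun s : self_bimod S => x *r: s).
Proof. by move=> a s t; rewrite ractDr [_ *: (x *r: s)]ractA. Qed.

(** Turns the element [x] into a morphism of right modules, to which naturality applies. *)
Definition ract_elem (x : X) : {linear self_bimod S -> X} :=
  mk_linear (ract_elem_linear x).
End RightAction.

Section LeftAction.
Variables (R S : pzRingType) (X : bimodType R S).

Fact lact_elem_linear (r : R) : linear (fun x : X => r *l: x).
Proof. by move=> a x y; rewrite lactDr lactZ. Qed.

Definition lact_elem (r : R) : {linear X -> X} :=
  mk_linear (lact_elem_linear r).
End LeftAction.

Section Main.
Variables (R S : pzRingType) (M : bimodType R S).
Local Notation MM := (tensor (dualmod M) M).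

Lemma ev_sum n (f : 'I_n -> dualmod M) (m : 'I_n -> M) :
  ev M (\sum_(i < n) f i *t: m i) = \sum_(i < n) f i (m i).
Proof. by rewrite linear_sum; apply: eq_bigr => i _; rewrite evE. Qed.

Lemma ract_sum n (x : M) (s : 'I_n -> S) :
  x *r: (\sum_(i < n) s i) = \sum_(i < n) x *r: s i.
Proof. by rewrite /ract scaler_suml. Qed.

Fact coev_elem_linear (f : dualmod M) : linear (fun m => f *t: m : MM).
Proof. by move=> s m m'; rewrite tensDr -[s *: m]/(m *r: s) -tens_ractE. Qed.

Definition coev_elem (f : dualmod M) : HomR M MM :=
  mk_linear (coev_elem_linear f).

Fact coev_linear : linear (coev_elem : HomR M (self_bimod S) -> HomR M MM).
Proof.
move=> r f f'; apply: homR_ext => m.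
by rewrite /= tensDl -[r *: f]/((f : dualmod M) *r: r) tensM.
Qed.

(** The unit at [dualmod M] of the adjunction between tensoring with [M] over [R] and
    [sigma_star M]. *)
Definition coev : {linear HomR M (self_bimod S) -> HomR M MM} :=
  mk_linear coev_linear.

(** * From semiseparability to regularity and surjectivity *)

Section Retraction.
Variable P : hom_nat_trans (sigma_star M).
Hypothesis PK : forall (X Y : lmodType S^c) (h : {linear X -> Y}),
  fmor (sigma_star M) (P X Y (fmor (sigma_star M) h)) = fmor (sigma_star M) h.

Definition retract (X Y : lmodType S^c) (g : {linear HomR M X -> HomR M Y}) :
  {linear X -> Y} := P X Y g.

(** Since [g'] is compared only pointwise, one map can be presented as a composite in two ways. *)
Lemma retract_natural (X X' Y Y' : lmodType S^c)
    (h : {linear X' -> X}) (k : {linear Y -> Y'})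
    (g : {linear HomR M X -> HomR M Y}) (g' : {linear HomR M X' -> HomR M Y'}) :
  (forall phi m, g' phi m = k (g (homR_post h phi) m)) ->
  forall x, retract g' x = k (retract g (h x)).
Proof.
move=> g'E x; rewrite /retract.
have := @hnt_natural _ _ _ P X X' Y Y' h k g.
set g'' := mcomp _ _ => /(congr1 (fun u : {linear X' -> Y'} => u x)) /= <-.
by congr (hnt P _ x); apply: linear_ext => phi; apply: homR_ext.
Qed.

(** This is [PK] at the identity of [X], evaluated at [phi]. *)
Lemma retractK (X : lmodType S^c) (phi : HomR M X) m :
  retract (idfun : {linear HomR M X -> HomR M X}) (phi m) = phi m.
Proof.
have /(congr1 (fun u : {linear HomR M X -> HomR M X} => u phi m)) :=
  @PK X X idfun.
have -> : fmor (sigma_star M) (idfun : {linear X -> X}) = idfun.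
  exact: (fmor1 (sigma_star M) X).
exact.
Qed.

Definition coev_retract : {linear self_bimod S -> MM} := retract coev.

Lemma coev_retract_lact (s : S) x :
  coev_retract (s *l: x) = s *l: coev_retract x.
Proof.
(* As [coev] commutes with the left action of [s], naturality in either variable computes
   [retract g]. *)
pose g : {linear HomR M (self_bimod S) -> HomR M MM} :=
  coev \o mk_linear (homR_post_linear (M := M) (lact_elem (self_bimod S) s)).
have gl := @retract_natural _ _ _ _ (lact_elem (self_bimod S) s) idfun coev g.
have gr := @retract_natural _ _ _ _ idfun (lact_elem MM s) coev g.
rewrite -[LHS]gl // [LHS]gr // => phi m /=.
by rewrite tens_lactE; congr (_ *t: _); apply: homR_ext.
Qed.

Definition coev_bimodHom : bimodHom (self_bimod S) MM :=
  BimodHom coev_retract_lact.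

(** By the triangle identity, [coev] followed by composition with [ev M] is the identity; apply
    naturality in the target. *)
Lemma ev_coev_retract x : ev M (coev_retract x) =
  retract (idfun : {linear HomR M (self_bimod S) -> HomR M (self_bimod S)}) x.
Proof.
symmetry; apply: (@retract_natural _ _ _ _ idfun (ev M) coev idfun).
by move=> phi m; rewrite [RHS]evE.
Qed.

Lemma ev_coev_retractK t : ev M (coev_retract (ev M t)) = ev M t.
Proof.
move: t; apply: (tens_ext (f := fun t => ev M (coev_retract (ev M t)))).
- by move=> x y; rewrite !linearB.
- by move=> x y; rewrite linearB.
- by move=> f m; rewrite ev_coev_retract evE retractK.
Qed.

Lemma ev_regular : @regular_mor (BiMod S S) MM (self_bimod S) (ev M).
Proof.
by exists coev_bimodHom; apply: bimodHom_ext => t; apply: ev_coev_retractK.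
Qed.

Lemma ract_ev_coev (m : M) : m *r: ev M (coev_retract 1) = m.
Proof.
rewrite ev_coev_retract.
have mE := @retractK M (idfun : HomR M M) m.
rewrite -[RHS]mE /=.
(* Composition with [s |-> m s]: at 1, naturality in the target gives [m e], in the source the
   retraction of the identity at [m]. *)
pose g : {linear HomR M (self_bimod S) -> HomR M M} :=
  mk_linear (homR_post_linear (M := M) (ract_elem m)).
have gl := @retract_natural _ _ _ _ idfun (ract_elem m) idfun g.
have gr := @retract_natural _ _ _ _ (ract_elem m) idfun idfun g.
rewrite -[LHS]gl // [LHS]gr //=.
by rewrite ract1.
Qed.

Lemma id_tens_ev_surj (y : tensor M (self_bimod S)) :
  exists x : tensor M MM, id_tens_ev M x = y.
Proof.
elim/tens_ind: y => [|_ _ [x <-] [y <-]|m s].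
- by exists 0; rewrite linear0.
- by exists (x - y); rewrite linearB.
(* With [e = ev (gamma 1)], the image is [m (x) e s = m e (x) s], and [m e = m]. *)
- exists (m *t: coev_retract s); rewrite /id_tens_ev tens_mapE /=.
  rewrite -[in RHS](ract_ev_coev m) tensM; congr (_ *t: _).
  rewrite self_lactE -[RHS]self_ractE -!lin_ract.
  by congr (ev M (coev_retract _)); exact/esym/(@mul1r S).
Qed.
End Retraction.

(** * From regularity and surjectivity to an invariant element *)

Section Regular.
Variable gamma : bimodHom (self_bimod S) MM.
Hypothesis evK : forall x, ev M (gamma (ev M x)) = ev M x.
Hypothesis surj : forall y, exists x, id_tens_ev M x = y.

Lemma gamma1_invariant : bimod_invariant (gamma 1).
Proof.
move=> s; rewrite -bimodHom_lact -lin_ract; congr (gamma _).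
by rewrite self_lactE self_ractE mulr1 mul1r.
Qed.

Lemma ract_ev_regular (m : M) : m *r: ev M (gamma 1) = m.
Proof.
(* By [evK], the maps induced by [act] and [act'] agree on the image of [id_tens_ev M], which is
   everything; compare them at [m (x) 1]. *)
pose act (m : M) (s : self_bimod S) : M := m *r: s.
pose act' (m : M) (s : self_bimod S) : M := m *r: ev M (gamma s).
have actP : balanced act.
  by split=> *; rewrite /act ?ractDl ?ractDr ?ractA.
have act'P : balanced act'.
  split=> *; rewrite /act' ?ractDl ?linearD ?ractDr ?ractA //.
  by rewrite !bimodHom_lact.
have actE t : tens_lift act' (id_tens_ev M t) = tens_lift act (id_tens_ev M t).
  move: t; apply: (tens_ext (f := fun t => tens_lift act' (id_tens_ev M t))
                            (g := fun t => tens_lift act (id_tens_ev M t))).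
  - by move=> x y; rewrite linearB tens_liftB.
  - by move=> x y; rewrite linearB tens_liftB.
  - by move=> x t; rewrite /id_tens_ev tens_mapE !tens_liftE // /act' evK.
have [x xE] := surj (m *t: (1 : self_bimod S)).
have := actE x; rewrite xE !tens_liftE // /act /act' => ->.
exact: ract1.
Qed.

Lemma regular_M_semiseparable : M_semiseparable M.
Proof.
have [n [f [m gammaE]]] := tensor_sum (gamma 1).
exists n, f, m; split=> [|x]; rewrite -?gammaE; first exact: gamma1_invariant.
by rewrite -ract_sum -ev_sum -gammaE ract_ev_regular.
Qed.
End Regular.

(** * From an invariant element to a retraction *)

Section InvariantElement.
Variables (n : nat) (f : 'I_n -> dualmod M) (m : 'I_n -> M).
Let z : MM := \sum_(i < n) f i *t: m i.
Hypothesis zS : bimod_invariant z.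
Hypothesis actz : forall x : M, \sum_(i < n) x *r: f i (m i) = x.

Definition apply_elem (X Y : lmodType S^c)
    (g : {linear HomR M X -> HomR M Y}) (x : X) (f : dualmod M) (m : M) : Y :=
  g (homR_post (ract_elem x) f) m.

(** The middle relation is the [R]-linearity of [g]. *)
Lemma apply_elem_balanced (X Y : lmodType S^c)
    (g : {linear HomR M X -> HomR M Y}) (x : X) : balanced (apply_elem g x).
Proof.
split=> [f1 f2 m1|f1 m1 m2|f1 r m1]; rewrite /apply_elem.
- rewrite -homR_addE -linearD; congr (g _ _); apply: homR_ext => u.
  by rewrite /= ractDr.
- by rewrite linearD.
- rewrite -homR_ractE -lin_ract; congr (g _ _); exact: homR_ext.
Qed.

(** Evaluating on the tensor [z], not on its summands, lets the invariance of [z] be used. *)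
Definition section_fun (X Y : lmodType S^c)
    (g : {linear HomR M X -> HomR M Y}) (x : X) : Y :=
  tens_lift (apply_elem g x) z.

Lemma section_funE (X Y : lmodType S^c)
    (g : {linear HomR M X -> HomR M Y}) (x : X) :
  section_fun g x = \sum_(i < n) apply_elem g x (f i) (m i).
Proof.
have gP := apply_elem_balanced g x; rewrite /section_fun /z.
rewrite (big_morph _ (tens_liftD gP) (tens_lift0 gP)).
by apply: eq_bigr => i _; rewrite tens_liftE.
Qed.

(** From [(x s) f = x (s f)], the scalar passes to [s z], which is [z s]; the right linear values of
    [g] then release it. *)
Lemma section_fun_ract (X Y : lmodType S^c)
    (g : {linear HomR M X -> HomR M Y}) (x : X) (s : S) :
  section_fun g (x *r: s) = section_fun g x *r: s.
Proof.
have gxP := apply_elem_balanced g x.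
have gxsP := apply_elem_balanced g (x *r: s).
transitivity (tens_lift (apply_elem g x) (s *l: z)).
  rewrite /section_fun; move: z.
  apply: (tens_ext (g := fun t : MM => tens_lift (apply_elem g x) (s *l: t))).
  - exact: tens_liftB.
  - move=> t t'; rewrite -tens_liftB //; congr tens_lift.
    exact: (linearB (lact_elem MM s)).
  - move=> f1 m1; rewrite tens_lactE !tens_liftE //.
    by congr (g _ _); apply: homR_ext => u; rewrite /= ractA.
rewrite zS /section_fun; move: z.
apply: (tens_ext (f := fun t : MM => tens_lift (apply_elem g x) (t *r: s))
                 (g := fun t => tens_lift (apply_elem g x) t *r: s)).
- by move=> t t'; rewrite /ract scalerBr tens_liftB.
- by move=> t t'; rewrite tens_liftB // /ract scalerBr.
- by move=> f1 m1; rewrite tens_ractE !tens_liftE // /apply_elem lin_ract.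
Qed.

Lemma section_fun_linear (X Y : lmodType S^c)
    (g : {linear HomR M X -> HomR M Y}) : linear (section_fun g).
Proof.
move=> s x y; rewrite -[s *: section_fun g x]section_fun_ract !section_funE.
rewrite -big_split; apply: eq_bigr => i _.
rewrite /apply_elem /= -homR_addE -linearD; congr (g _ _).
by apply: homR_ext => u; rewrite /= ractDl.
Qed.

Lemma section_natural (X X' Y Y' : lmodType S^c)
    (h : {linear X' -> X}) (k : {linear Y -> Y'})
    (g : {linear HomR M X -> HomR M Y}) (g' : {linear HomR M X' -> HomR M Y'}) :
  (forall phi m, g' phi m = k (g (homR_post h phi) m)) ->
  forall x, section_fun g' x = k (section_fun g (h x)).
Proof.
move=> g'E x; rewrite !section_funE linear_sum; apply: eq_bigr => i _.
rewrite /apply_elem g'E; congr (k (g _ _)).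
by apply: homR_ext => u; rewrite /= lin_ract.
Qed.

Definition section_nat : hom_nat_trans (sigma_star M).
Proof.
refine (@HomNatTrans (RightMod S) (RightMod R) (sigma_star M)
  (fun (X Y : lmodType S^c) (g : {linear HomR M X -> HomR M Y}) =>
     mk_linear (section_fun_linear g)) _).
move=> X X' Y Y' h k g; apply: linear_ext => x.
exact: section_natural.
Defined.

Lemma M_semiseparable_semiseparable : semiseparable (sigma_star M).
Proof.
exists section_nat => X Y h; apply: linear_ext => phi; apply: homR_ext => x.
rewrite -[LHS]/(section_fun (mk_linear (homR_post_linear (M := M) h)) (phi x)).
(* The identity is needed only at values [phi x], so [actz] can be used inside [phi]. *)
rewrite section_funE -[RHS]/(h (phi x)) -[in RHS](actz x) !linear_sum.
apply: eq_bigr => i _.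
by rewrite /apply_elem /= !lin_ract.
Qed.
End InvariantElement.
End Main.

Theorem theorem3p18 (R S : pzRingType) (M : bimodType R S) :
  [<-> semiseparable (sigma_star M);
       @regular_mor (BiMod S S) (tensor (dualmod M) M) (self_bimod S) (ev M) /\
       (forall y : tensor M (self_bimod S),
          exists x : tensor M (tensor (dualmod M) M), id_tens_ev M x = y);
       M_semiseparable M].
Proof.
tfae.
- by move=> [P PK]; split; [exact: ev_regular PK | exact: id_tens_ev_surj PK].
- move=> [[gamma gammaP] surj].
  apply: (regular_M_semiseparable (gamma := gamma)) => // x.
  exact: (congr1 (fun u : bimodHom _ _ => u x) gammaP).
- move=> [n [f [m [zS actz]]]].
  exact: M_semiseparable_semiseparable zS actz.
Qed.
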